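(* Let $n\ge 1$ be an integer, and let $G(1,1,n)\subset \mathbf{GL}_{\mathbb{R}}(\mathbb{C}^3)$ be the subgroup generated by the operators $(z_1,z_2,z_3)\mapsto(\lambda z_1,\lambda z_2,\lambda^n z_3)$ ($\lambda\in\mathbb{T}$) and $(z_1,z_2,z_3)\mapsto(\overline{z}_1,\overline{z}_2,\overline{z}_3)$. Then the linear group $G(1,1,n)$ admits an $\mathbb{R}$-polynomial factorization map $\mathbb{C}^3\to\mathbb{R}^5$. More precisely, in terms of the $\mathbb{R}$-linear coordinates $w_1:=z_1+iz_2$, $w_2:=\overline{z_1-iz_2}=\overline{z}_1+i\overline{z}_2$, $w_3:=z_3$ on $\mathbb{C}^3$, this linear group is generated by the operators $(w_1,w_2,w_3)\mapsto(\lambda w_1,\overline{\lambda}w_2,\lambda^n w_3)$ ($\lambda\in\mathbb{T}$) and $(w_1,w_2,w_3)\mapsto(w_2,w_1,\overline{w}_3)$, and the $\mathbb{R}$-polynomial map $$\mathbb{C}^3\to\mathbb{C}^2\oplus\mathbb{R}\cong\mathbb{R}^5,\qquad (w_1,w_2,w_3)\mapsto\Bigl(w_2^nw_3+w_1^n\overline{w}_3,\ w_1w_2,\ |w_3|^2-\bigl(|w_1|^{2n}+|w_2|^{2n}\bigr)\Bigr)$$ is a factorization map of it.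
   Context: $\mathbb{T}=\{\lambda\in\mathbb{C}:|\lambda|=1\}$. $\mathbf{GL}_{\mathbb{R}}(\mathbb{C}^3)$ is the group of invertible $\mathbb{R}$-linear operators on $\mathbb{C}^3$. A map $f\colon\mathbb{C}^3\to V$ to a real vector space $V$ is a factorization map of a linear group $G\subset\mathbf{GL}_{\mathbb{R}}(\mathbb{C}^3)$ if it is surjective and its fibres coincide with the orbits of $G$ on $\mathbb{C}^3$ (that is, $f(x)=f(y)$ if and only if $y\in Gx$). A map is $\mathbb{R}$-polynomial if it is polynomial as a map of real vector spaces (in the real and imaginary parts of the coordinates). *)

(* Defs.v *)
From HB Require Import structures.
From mathcomp Require Import all_boot all_order all_algebra.
From mathcomp Require Import boolp classical_sets reals.
From mathcomp Require Import complex.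
From mathcomp Require mpoly.

Set Implicit Arguments.
Unset Strict Implicit.
Unset Printing Implicit Defensive.

Import Order.TTheory GRing.Theory Num.Theory.
Local Open Scope classical_set_scope.
Local Open Scope ring_scope.

Section LinearGroups.
Context {R : realType} {V : lmodType R}.

(* Invertible linear operators of [V], as a set of functions. *)
Definition GL : set (V -> V) := [set g | linear g /\ bijective g].

Record is_linear_group (G : set (V -> V)) : Prop := IsLinearGroup {
  linear_group_GL : G `<=` GL;
  linear_group_id : G idfun;
  linear_group_comp : forall g h, G g -> G h -> G (g \o h);
  linear_group_inv : forall g h, G g -> cancel g h -> cancel h g -> G h
}.

(* The intersection of all linear groups containing [S]. It is the subgroup of
   [GL] generated by [S] when [S `<=` GL], and the set of all maps otherwise. *)
Definition generated_group (S : set (V -> V)) : set (V -> V) :=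
  smallest is_linear_group S.

Definition factorization_map {W : Type} (G : set (V -> V)) (f : V -> W) : Prop :=
  (forall w, exists v, f v = w) /\
  (forall x y, f x = f y <-> exists2 g, G g & y = g x).

End LinearGroups.

Section ComplexSpace.
Context {R : realType}.

(* [Rcomplex R] is [R[i]] viewed as a real vector space, with the real-valued
   modulus as its norm; hence [C3] is a vector space over [R]. *)
Definition C3 : lmodType R := (Rcomplex R * Rcomplex R * Rcomplex R)%type.

Definition real_coords (z : C3) : 'I_6 -> R :=
  tnth [tuple complex.Re z.1.1; complex.Im z.1.1;
              complex.Re z.1.2; complex.Im z.1.2;
              complex.Re z.2; complex.Im z.2].

(* No basis of the target is chosen: a map is polynomial when it is a
   combination of finitely many fixed vectors with polynomial coefficients. *)
Definition real_polynomial {V : lmodType R} (f : C3 -> V) : Prop :=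
  exists (m : nat) (p : 'I_m -> mpoly.mpoly 6 R) (v : 'I_m -> V),
    forall z, f z = \sum_(k < m) mpoly.meval (real_coords z) (p k) *: v k.

Definition group_11n (n : nat) : set (C3 -> C3) :=
  generated_group (
    [set g | exists2 l : Rcomplex R, `|l| = 1 &
       g = fun z => (l * z.1.1, l * z.1.2, l ^+ n * z.2)] `|`
    [set fun z => (conjc z.1.1, conjc z.1.2, conjc z.2)]).

Definition w_coords (z : C3) : C3 :=
  (z.1.1 + 'i%C * z.1.2, conjc (z.1.1 - 'i%C * z.1.2), z.2).

Definition w_generators (n : nat) : set (C3 -> C3) :=
  [set h | exists2 l : Rcomplex R, `|l| = 1 &
     h = fun w => (l * w.1.1, conjc l * w.1.2, l ^+ n * w.2)] `|`
  [set fun w => (w.1.2, w.1.1, conjc w.2)].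

(* The operators [g] that read as an element of [H] in the coordinates [phi]. *)
Definition in_coords (phi : C3 -> C3) (H : set (C3 -> C3)) : set (C3 -> C3) :=
  [set g | exists2 h, H h & forall z, phi (g z) = h (phi z)].

Definition w_map (n : nat) (w : C3) : (Rcomplex R * Rcomplex R * R^o)%type :=
  (w.1.2 ^+ n * w.2 + w.1.1 ^+ n * conjc w.2,
   w.1.1 * w.1.2,
   `|w.2| ^+ 2 - (`|w.1.1| ^+ (2 * n) + `|w.1.2| ^+ (2 * n))).

End ComplexSpace.

Arguments C3 R : clear implicits.

(* Main.v *)
Require Import Defs.
From HB Require Import structures.
From mathcomp Require Import all_boot all_order all_algebra.
From mathcomp Require Import boolp classical_sets reals.
From mathcomp Require Import topology normedtype realfun.
From mathcomp Require Import complex ring lra.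
From mathcomp Require mpoly.

Set Implicit Arguments.
Unset Strict Implicit.
Unset Printing Implicit Defensive.

Import (canonicals) mpoly.
Import Order.TTheory GRing.Theory Num.Theory numFieldNormedType.Exports.
Local Open Scope classical_set_scope.
Local Open Scope ring_scope.

(** Put [a = w2^n w3], [b = w1^n conj(w3)], [c = (w1 w2)^n], [r = |w3|^2] and
    let [(p, q, t)] be the image of [w]. Then [a + b = p], [a b = r c] and
    [|a|^2 + |b|^2 = r (r - t)], so the parallelogram law gives
      [2 r (r - t) = |p|^2 + |p^2 - 4 r c|], with [r >= max 0 (t + 2 |c|)]
    because [r - t = |w1|^2n + |w2|^2n]. For given [(p, c, t)] this equation has
    exactly one such solution [r]: existence is the intermediate value theorem,
    uniqueness the triangle inequality. So the image determines [r], hence the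
    unordered pair [{a, b}], which the swap [(w2, w1, conj w3)] exchanges; once
    the pair is ordered the moduli of the [wi] are determined (when [r = 0],
    those of [w1] and [w2] up to the swap), and the rest is a rotation by
    [l = w1' / w1] (or [w2 / w2'], or an [n]-th root of [w3' / w3]). Conversely
    [r], [a] and [b] are found from [(p, q, t)] and yield the [wi]. *)

(** The cast to [Rcomplex] makes the modulus real-valued; on [R[i]] the norm is itself a complex
    number. *)
Local Notation cmod z := (Num.norm (z : Rcomplex _)).
Local Notation cj z := (conjc z : Rcomplex _).

(** * Complex moduli and the equation for the radius [r] *)

Section ComplexModulus.
Context {R : realType}.
Implicit Types x y : Rcomplex R.

Lemma RcomplexP x y : complex.Re x = complex.Re y -> complex.Im x = complex.Im y -> x = y.
Proof. by case: x y => [a b] [c d] /= -> ->. Qed.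

Lemma cnormM x y : cmod (x * y) = cmod x * cmod y.
Proof. exact: Normc.normcM. Qed.

Lemma cnorm1 : cmod (1 : Rcomplex R) = 1.
Proof. exact: Normc.normc1. Qed.

Lemma cnormX x k : cmod (x ^+ k) = cmod x ^+ k.
Proof. by elim: k => [|k IH]; rewrite ?expr0 ?cnorm1 // !exprS cnormM IH. Qed.

Lemma cnormV x : cmod (x^-1) = (cmod x)^-1.
Proof. exact: Normc.normcV. Qed.

Lemma cnorm_sqr x : cmod x ^+ 2 = complex.Re x ^+ 2 + complex.Im x ^+ 2.
Proof. by case: x => a b; rewrite /Num.norm /= sqr_sqrtr // addr_ge0 ?sqr_ge0. Qed.

Lemma cnorm_conj x : cmod (cj x) = cmod x.
Proof. by case: x => a b; rewrite /Num.norm /= sqrrN. Qed.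

Lemma mulr_conj x : x * cj x = (cmod x ^+ 2)%:C%C.
Proof. by rewrite cnorm_sqr; case: x => a b; apply: RcomplexP => /=; ring. Qed.

Lemma cnorm_real (k : R) : cmod k%:C%C = `|k|.
Proof. by rewrite /Num.norm /= expr0n addr0 sqrtr_sqr. Qed.

Lemma scale_realE (k : R) x : k *: x = k%:C%C * x.
Proof. by case: x => a b; apply: RcomplexP => /=; ring. Qed.

Lemma two_neq0 : (2 : Rcomplex R) != 0.
Proof. by have h : (2 : R[i]) != 0 by rewrite pnatr_eq0. Qed.

(** The last term is [|x - y|^2], written through the sum and the product because these are what the
    image of a point gives for [a] and [b]. *)
Lemma parallelogram x y :
  2 * (cmod x ^+ 2 + cmod y ^+ 2) = cmod (x + y) ^+ 2 + cmod ((x + y) ^+ 2 - 4 * (x * y)).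
Proof.
have -> : (x + y) ^+ 2 - 4 * (x * y) = (x - y) ^+ 2 by ring.
by rewrite cnormX !cnorm_sqr; case: x y => [a b] [c d] /=; ring.
Qed.

(** The quadratic formula for [X^2 - s X + p], with a complex square root of the discriminant. *)
Lemma sum_prod_roots (s p : Rcomplex R) : exists x y, x + y = s /\ x * y = p.
Proof.
pose d : Rcomplex R := sqrtc (s ^+ 2 - 4 * p).
have dE : d ^+ 2 = s ^+ 2 - 4 * p by exact: sqr_sqrtc.
have h2 := two_neq0.
exists ((s + d) / 2), ((s - d) / 2); split; first by field.
have -> : (s + d) / 2 * ((s - d) / 2) = (s ^+ 2 - d ^+ 2) / 4 by field.
by rewrite dE; field.
Qed.

(** Both pairs are the roots of one quadratic polynomial, so [x'] is a zero of [(X - x) (X - y)]. *)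
Lemma sum_prod_unique (x y x' y' : Rcomplex R) :
  x + y = x' + y' -> x * y = x' * y' -> (x' = x /\ y' = y) \/ (x' = y /\ y' = x).
Proof.
move=> hs hp.
have : (x' - x) * (x' - y) = 0.
  have -> : (x' - x) * (x' - y) = x' ^+ 2 - (x + y) * x' + x * y by ring.
  by rewrite hs hp; ring.
move/eqP; rewrite mulf_eq0 !subr_eq0 => /orP[] /eqP e; [left|right]; split=> //.
  by apply: (addrI x); rewrite hs e.
by apply: (addrI y); rewrite [RHS]addrC hs e.
Qed.

Lemma exists_root (k : nat) x : (0 < k)%N -> exists y : Rcomplex R, y ^+ k = x.
Proof. by move=> k0; exists (k.-root (x : R[i]))%C; exact: (rootCK k0 (x : R[i])). Qed.


Lemma cnorm_Re_Im x : cmod x = Num.sqrt (complex.Re x ^+ 2 + complex.Im x ^+ 2).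
Proof. by case: x. Qed.

Lemma cnorm_realM (k : R) x : cmod (k%:C%C * x) = `|k| * cmod x.
Proof. by rewrite cnormM cnorm_real. Qed.

(** Suppose [r' < r]. From [r'] to [r] the left side grows by [2 (r - r') (r + r' - t)] and the
    right side by at most [4 (r - r') |c|], so [r + r' - t <= 2 |c|]. But [r' - t >= 2 |c|] and
    [r > r' >= 0], a contradiction. *)
Lemma radius_unique (p c : Rcomplex R) (t r r' : R) :
  0 <= r -> t + 2 * cmod c <= r -> 0 <= r' -> t + 2 * cmod c <= r' ->
  2 * (r * (r - t)) = cmod p ^+ 2 + cmod (p ^+ 2 - 4 * (r%:C%C * c)) ->
  2 * (r' * (r' - t)) = cmod p ^+ 2 + cmod (p ^+ 2 - 4 * (r'%:C%C * c)) ->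
  r = r'.
Proof.
wlog lt : r r' / r' < r => [hw r0 rt r0' rt' e e'|].
  have [l|l|//] := ltgtP r r'; last exact: hw.
  by apply/esym/hw.
move=> r0 rt r0' rt' e e'.
have tri : cmod (p ^+ 2 - 4 * (r%:C%C * c)) <=
    cmod (p ^+ 2 - 4 * (r'%:C%C * c)) + 4 * (r - r') * cmod c.
  have -> : p ^+ 2 - 4 * (r%:C%C * c) =
    (p ^+ 2 - 4 * (r'%:C%C * c)) + (4 * (r' - r))%:C%C * c.
    by rewrite rmorphM rmorphB /= rmorph_nat; ring.
  apply: (le_trans (ler_normD _ _)).
  rewrite lerD2l cnorm_realM normrM distrC ger0_norm // ger0_norm // subr_ge0.
  exact: ltW.
have : 2 * (r - r') * (r + r' - t) <= 2 * (r - r') * (2 * cmod c).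
  lra.
rewrite ler_pM2l; last by rewrite mulr_gt0 // subr_gt0.
lra.
Qed.

(** The intermediate value theorem, applied to the difference of the two sides between the least
    admissible radius [a] and a sufficiently large [b]. *)
Lemma radius_exists (p c : Rcomplex R) (t : R) : exists r : R,
  [/\ 0 <= r, t + 2 * cmod c <= r &
  2 * (r * (r - t)) = cmod p ^+ 2 + cmod (p ^+ 2 - 4 * (r%:C%C * c))].
Proof.
pose a := Num.max 0 (t + 2 * cmod c).
pose b := a + 1 + cmod p ^+ 2.
(* The modulus is spelled out as a square root of a real polynomial in [r], so that continuity
   concerns real functions only; [fE] restores it. *)
pose f (r : R) := 2 * (r * (r - t)) - cmod p ^+ 2 -
  Num.sqrt ((complex.Re (p ^+ 2) - 4 * (r * complex.Re c)) ^+ 2 +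
            (complex.Im (p ^+ 2) - 4 * (r * complex.Im c)) ^+ 2).
have fE r : f r = 2 * (r * (r - t)) - cmod p ^+ 2 - cmod (p ^+ 2 - 4 * (r%:C%C * c)).
  have -> : 4 = 4%:C%C :> Rcomplex R by rewrite rmorph_nat.
  rewrite /f [X in _ = _ - X]cnorm_Re_Im; rewrite !raddfB /=.
  by rewrite !mulrA -!rmorphM /= -!scale_realE !linearZ.
have fc : continuous f.
  have cst (k : R) : continuous (fun _ : R => k) by move=> x; exact: cvg_cst.
  have mul (g h : R -> R) : continuous g -> continuous h -> continuous (fun r => g r * h r).
    by move=> gc hc x; apply: cvgM; [exact: gc|exact: hc].
  have sub (g h : R -> R) : continuous g -> continuous h -> continuous (fun r => g r - h r).
    by move=> gc hc x; apply: cvgB; [exact: gc|exact: hc].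
  have add (g h : R -> R) : continuous g -> continuous h -> continuous (fun r => g r + h r).
    by move=> gc hc x; apply: cvgD; [exact: gc|exact: hc].
  have idc : continuous (fun r : R => r) by move=> x; exact: cvg_id.
  apply: (sub).
    by do ![exact: idc | exact: cst | apply: (sub) | apply: (mul)].
  move=> x; apply: continuous_comp; last exact: sqrt_continuous.
  move: x; apply: add; apply: (mul); apply: (sub);
    by do ![exact: idc | exact: cst | apply: (mul)].
have p0 : 0 <= cmod p ^+ 2 by rewrite sqr_ge0.
have c0 : 0 <= cmod c by [].
have ab : a <= b by rewrite /b -addrA lerDl addr_ge0.
have a0 : 0 <= a by rewrite le_max lexx.
have ac : t + 2 * cmod c <= a by rewrite le_max lexx orbT.
(* If [t + 2 |c| < 0], then [a = 0] and the product [a (a - t)] vanishes. Otherwise [a - t = 2 |c|],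
   so [2 a (a - t) = |4 a c|], which is at most [|p|^2 + |p^2 - 4 a c|]. *)
have fa : f a <= 0.
  rewrite fE /a; have [h|h] := leP 0 (t + 2 * cmod c); last first.
    rewrite mul0r mulr0 sub0r; have := normr_ge0 (p ^+ 2 - 4 * (0%:C%C * c) : Rcomplex R); lra.
  have := ler_normB (p ^+ 2 - 4 * ((t + 2 * cmod c)%:C%C * c) : Rcomplex R) (p ^+ 2).
  rewrite addrAC subrr sub0r normrN cnormX.
  have -> : 4 * ((t + 2 * cmod c)%:C%C * c) = (4 * (t + 2 * cmod c))%:C%C * c :> Rcomplex R.
    by rewrite rmorphM /= rmorph_nat mulrA.
  have pos : 0 <= 4 * (t + 2 * cmod c) by rewrite mulr_ge0.
  rewrite cnorm_realM (ger0_norm pos); lra.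
(* As [|p^2 - 4 b c| <= |p|^2 + 4 b |c|], it suffices that [|p|^2 <= b (b - t - 2 |c|)]. The choice
   of [b] makes the second factor at least [1 + |p|^2] and the first at least 1. *)
have fb : 0 <= f b.
  rewrite fE.
  have := ler_normB (p ^+ 2 : Rcomplex R) (4 * (b%:C%C * c)).
  have -> : 4 * (b%:C%C * c) = (4 * b)%:C%C * c :> Rcomplex R.
    by rewrite rmorphM /= rmorph_nat mulrA.
  have pos : 0 <= 4 * b by rewrite mulr_ge0 // (le_trans a0).
  rewrite cnorm_realM (ger0_norm pos) cnormX => tri.
  have : (1 + cmod p ^+ 2) * 1 <= (b - t - 2 * cmod c) * b.
    apply: ler_pM => //; rewrite /b; lra.
  lra.
have [|r] := @IVT R f a b 0 ab (continuous_subspaceT fc).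
  by rewrite ge_min le_max fa fb orbT.
rewrite in_itv /= => /andP[ar _] fr; exists r; split.
- exact: le_trans ar.
- exact: le_trans ar.
- by move: fr; rewrite fE; lra.
Qed.
End ComplexModulus.

(** * Points with the same image lie in one orbit *)

Section Orbit.
Context {R : realType}.
Implicit Types w x y l : Rcomplex R.

Lemma cjD x y : cj (x + y) = cj x + cj y.
Proof. exact: rmorphD. Qed.

Lemma cjB x y : cj (x - y) = cj x - cj y.
Proof. exact: rmorphB. Qed.

Lemma cjM x y : cj (x * y) = cj x * cj y.
Proof. exact: rmorphM. Qed.

Lemma cjX x k : cj (x ^+ k) = cj x ^+ k.
Proof. exact: rmorphXn. Qed.

Lemma cj_unit l : cmod l = 1 -> cj l = l^-1.
Proof.
move=> l1; have l0 : l != 0 by rewrite -normr_eq0 l1 oner_eq0.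
by apply: (mulfI l0); rewrite divff // mulr_conj l1 expr1n.
Qed.

Lemma cmod_div x y : cmod x = cmod y -> y != 0 -> cmod (x / y) = 1.
Proof. by move=> e y0; rewrite cnormM cnormV e divff // normr_eq0. Qed.

Lemma cmod_expI (k : nat) x y : (0 < k)%N -> cmod x ^+ k = cmod y ^+ k -> cmod x = cmod y.
Proof. by move=> k0 /(pexpIrn k0); apply; rewrite nnegrE. Qed.

(** A nonzero coordinate determines [l], and the invariant products containing that coordinate then
    force the other two. If [w1 = w2 = 0], only [w3] matters, and an [n]-th root of the phase
    [w3' / w3] serves. *)
Lemma torus_orbit (n : nat) w1 w2 w3 w1' w2' w3' : (0 < n)%N ->
  cmod w1' = cmod w1 -> cmod w2' = cmod w2 -> cmod w3' = cmod w3 ->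
  w1' * w2' = w1 * w2 -> w2' ^+ n * w3' = w2 ^+ n * w3 ->
  w1' ^+ n * cj w3' = w1 ^+ n * cj w3 ->
  exists2 l, cmod l = 1 &
    [/\ w1' = l * w1, w2' = cj l * w2 & w3' = l ^+ n * w3].
Proof.
move=> n0 e1 e2 e3 q a b.
have nz x y : cmod y = cmod x -> x != 0 -> y != 0 by rewrite -(normr_eq0 x) -(normr_eq0 y) => ->.
have [w10|w10] := eqVneq w1 0; last first.
  have w10' := nz _ _ e1 w10; have l1 := cmod_div e1 w10.
  exists (w1' / w1) => //; split; first by rewrite divfK.
    by rewrite cj_unit // invf_div mulrAC -q mulrAC divff ?mul1r.
  (* The claim on [w3'] is conjugated because [w1] enters the invariants together with
     [conj(w3)]. *)
  apply: (can_inj (@conjcK R)); rewrite (cjM _ w3) cjX cj_unit // invf_div.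
  apply: (mulfI (expf_neq0 n w10')); rewrite [LHS]b mulrA -exprMn.
  by rewrite mulrCA divff ?mulr1.
have [w20|w20] := eqVneq w2 0; last first.
  have w20' := nz _ _ e2 w20; have l1 := cmod_div (esym e2) w20'.
  exists (w2 / w2') => //; split.
  - by apply/eqP; rewrite w10 mulr0 -normr_eq0 e1 w10 normr0.
  - by rewrite cj_unit // invf_div divfK.
  - apply: (mulfI (expf_neq0 n w20')); rewrite [LHS]a mulrA -exprMn.
    by rewrite mulrCA divff ?mulr1.
have z1 : w1' = 0 by apply/eqP; rewrite -normr_eq0 e1 w10 normr0.
have z2 : w2' = 0 by apply/eqP; rewrite -normr_eq0 e2 w20 normr0.
have [w30|w30] := eqVneq w3 0.
  have z3 : w3' = 0 by apply/eqP; rewrite -normr_eq0 e3 w30 normr0.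
  by exists 1; [exact: cnorm1|rewrite z1 z2 z3 w10 w20 w30 !mulr0].
have [l lE] := exists_root (w3' / w3) n0.
exists l; last by rewrite lE divfK // z1 z2 w10 w20 !mulr0.
have : cmod l ^+ n = cmod 1 ^+ n by rewrite -cnormX lE cmod_div // cnorm1 expr1n.
by move/(cmod_expI n0)=> ->; exact: cnorm1.
Qed.

(** With [r - t = |w1|^2n + |w2|^2n], these are the bound and the equation required by
    [radius_unique]. The bound is the inequality of the means; the equation is the parallelogram law
    for [a] and [b], whose product is [r c]. *)
Lemma w_radius (n : nat) w1 w2 w3 :
  2 * cmod ((w1 * w2) ^+ n) <= cmod w1 ^+ (2 * n) + cmod w2 ^+ (2 * n) /\
  2 * (cmod w3 ^+ 2 * (cmod w1 ^+ (2 * n) + cmod w2 ^+ (2 * n))) =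
    cmod (w2 ^+ n * w3 + w1 ^+ n * cj w3) ^+ 2 +
    cmod ((w2 ^+ n * w3 + w1 ^+ n * cj w3) ^+ 2 -
      4 * ((cmod w3 ^+ 2)%:C%C * (w1 * w2) ^+ n)).
Proof.
rewrite !(mulnC 2%N n) !exprM; split.
  rewrite cnormX cnormM exprMn -subr_ge0.
  have -> : (cmod w1 ^+ n) ^+ 2 + (cmod w2 ^+ n) ^+ 2 - 2 * (cmod w1 ^+ n * cmod w2 ^+ n)
    = (cmod w1 ^+ n - cmod w2 ^+ n) ^+ 2 by ring.
  exact: sqr_ge0.
rewrite -mulr_conj.
have -> : w3 * cj w3 * (w1 * w2) ^+ n = (w2 ^+ n * w3) * (w1 ^+ n * cj w3).
  by rewrite exprMn; ring.
rewrite -parallelogram !cnormM !cnormX cnorm_conj; ring.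
Qed.

(** The data determine [(u + v)^2], hence [u + v] by nonnegativity. This recovers the moduli of [w1]
    and [w2] when [w3 = 0]. *)
Lemma sum_sqr_prod_unique (u v u' v' : R) : 0 <= u -> 0 <= v -> 0 <= u' -> 0 <= v' ->
  u' ^+ 2 + v' ^+ 2 = u ^+ 2 + v ^+ 2 -> u' * v' = u * v ->
  (u' = u /\ v' = v) \/ (u' = v /\ v' = u).
Proof.
move=> u0 v0 u0' v0' s p.
have se : u' + v' = u + v.
  apply: (pexpIrn (isT : (0 < 2)%N)); rewrite ?nnegrE ?addr_ge0 //; nra.
have : (u' - u) * (u' - v) = 0 by nra.
by move/eqP; rewrite mulf_eq0 !subr_eq0 => /orP[] /eqP e; [left|right]; split=> //; lra.
Qed.

Lemma w_fibre (n : nat) w1 w2 w3 w1' w2' w3' : (0 < n)%N ->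
  w2' ^+ n * w3' + w1' ^+ n * cj w3' = w2 ^+ n * w3 + w1 ^+ n * cj w3 ->
  w1' * w2' = w1 * w2 ->
  cmod w3' ^+ 2 - (cmod w1' ^+ (2 * n) + cmod w2' ^+ (2 * n)) =
    cmod w3 ^+ 2 - (cmod w1 ^+ (2 * n) + cmod w2 ^+ (2 * n)) ->
  exists2 l, cmod l = 1 &
    [/\ w1' = l * w1, w2' = cj l * w2 & w3' = l ^+ n * w3] \/
    [/\ w1' = l * w2, w2' = cj l * w1 & w3' = l ^+ n * cj w3].
Proof.
move=> n0 p q t.
have [c1 r1] := w_radius n w1 w2 w3; have [c2 r2] := w_radius n w1' w2' w3'.
have r : cmod w3' ^+ 2 = cmod w3 ^+ 2.
  move: r1 r2 c1 c2 t; rewrite p q.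
  set s := _ + _ ^+ (2 * n); set s' := _ + _ ^+ (2 * n) => r1 r2 c1 c2 t.
  apply: (radius_unique (t := cmod w3 ^+ 2 - s) (c := (w1 * w2) ^+ n)
    (p := w2 ^+ n * w3 + w1 ^+ n * cj w3)); rewrite ?sqr_ge0 //.
  - by rewrite -t; lra.
  - by lra.
  - by rewrite -t -r2; congr (2 * (_ * _)); lra.
  - by rewrite -r1; congr (2 * (_ * _)); lra.
have e3 : cmod w3' = cmod w3 by apply: (cmod_expI _ r).
have {t}s : cmod w1' ^+ (2 * n) + cmod w2' ^+ (2 * n) = cmod w1 ^+ (2 * n) + cmod w2 ^+ (2 * n).
  by rewrite r in t; lra.
(* The product [a b = r c] depends on [q] and [r] alone; together with the sum [p] it fixes the pair
   up to order. *)
have ab : (w2' ^+ n * w3') * (w1' ^+ n * cj w3') = (w2 ^+ n * w3) * (w1 ^+ n * cj w3).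
  have E x y z : (y ^+ n * z) * (x ^+ n * cj z) = (x * y) ^+ n * (z * cj z).
    by rewrite exprMn; ring.
  by rewrite !E !mulr_conj q r.
clear r1 r2 c1 c2.
have cmodE x y : cmod x * cmod w3' = cmod y * cmod w3 -> w3 != 0 -> cmod x = cmod y.
  by rewrite e3 -normr_eq0 => + h; exact: mulIf.
(* Here [x] stands for [w] or its swap. For [w3 != 0] the moduli come from dividing [|a|] and [|b|]
   by [|w3|]; for [w3 = 0] both [a] and [b] vanish, and the moduli must be supplied. *)
have key x1 x2 x3 : cmod x3 = cmod w3 -> x1 * x2 = w1 * w2 ->
   w2' ^+ n * w3' = x2 ^+ n * x3 -> w1' ^+ n * cj w3' = x1 ^+ n * cj x3 ->
   (w3 = 0 -> cmod w1' = cmod x1 /\ cmod w2' = cmod x2) ->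
   exists2 l, cmod l = 1 & [/\ w1' = l * x1, w2' = cj l * x2 & w3' = l ^+ n * x3].
  move=> ex3 eq ea eb h; have [e1 e2] : cmod w1' = cmod x1 /\ cmod w2' = cmod x2.
    have [/h//|w30] := eqVneq w3 0.
    split; apply: (cmod_expI n0); rewrite -!cnormX; apply: cmodE w30; rewrite -ex3.
      by rewrite -(cnorm_conj w3') -(cnorm_conj x3) -!cnormM eb.
    by rewrite -!cnormM ea.
  by apply: torus_orbit => //; [rewrite e3 ex3|rewrite q eq].
(* When [w3 = 0], the numbers [|w1|^n] and [|w2|^n] have a known sum of squares and a known product,
   so they are known up to exchange. *)
have [z3|nz3] := eqVneq w3 0.
  have z3' : w3' = 0 by apply/eqP; rewrite -normr_eq0 e3 z3 normr0.
  have := @sum_sqr_prod_unique (cmod w1 ^+ n) (cmod w2 ^+ n) (cmod w1' ^+ n) (cmod w2' ^+ n).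
  rewrite -!exprM ![(n * 2)%N]mulnC -!exprMn -!cnormM q.
  case=> //; rewrite ?exprn_ge0 // => -[/(cmod_expI n0) e1 /(cmod_expI n0) e2].
    have [|||||l l1 h] := @key w1 w2 w3 => //; rewrite ?z3 ?z3' ?(conjc0 R) ?mulr0 //.
    by move: h; rewrite z3 z3' => h; exists l => //; left.
  have [|||||l l1 h] := @key w2 w1 (cj w3);
    rewrite ?cnorm_conj ?z3 ?z3' ?conjcK ?(conjc0 R) ?mulr0 //.
    by rewrite mulrC.
  by move: h; rewrite z3 z3' ?(conjc0 R) => h; exists l => //; right.
(* The two orderings of the pair [{a, b}] correspond to [w] and to its swap. *)
have [[ea eb]|[ea eb]] := sum_prod_unique (esym p) (esym ab).
  have [|||||l l1 h] := @key w1 w2 w3 => //; first by move=> z; rewrite z eqxx in nz3.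
  by exists l => //; left.
have [|||||l l1 h] := @key w2 w1 (cj w3); rewrite ?cnorm_conj ?conjcK //.
- by rewrite mulrC.
- by move=> z; rewrite z eqxx in nz3.
by exists l => //; right.
Qed.
End Orbit.

(** * Every target value is attained *)

Section Surjectivity.
Context {R : realType}.
Implicit Types w x y : Rcomplex R.

Lemma exists_expn_modulus (n : nat) (u : R) : (0 < n)%N -> 0 <= u ->
  exists w, cmod w ^+ n = u.
Proof.
move=> n0 u0; have [w wE] := exists_root (u%:C%C : Rcomplex R) n0.
by exists w; rewrite -cnormX wE cnorm_real ger0_norm.
Qed.

(** Take [w1] of the right modulus and [w2 = q / w1]. If [w1 = 0], then [u = 0] forces [q = 0], and
    any [w2] of the right modulus will do. *)
Lemma exists_factors (n : nat) (q : Rcomplex R) (u v : R) : (0 < n)%N ->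
  0 <= u -> 0 <= v -> u * v = cmod q ^+ n ->
  exists w1 w2, [/\ cmod w1 ^+ n = u, cmod w2 ^+ n = v & w1 * w2 = q].
Proof.
move=> n0 u0 v0 uv.
have [x xE] := exists_expn_modulus n0 u0; have [x0|nx] := eqVneq x 0.
  have [y yE] := exists_expn_modulus n0 v0; exists x, y; split=> //.
  move/eqP: uv; rewrite -xE x0 normr0 expr0n -[n == 0]negbK -lt0n n0 mul0r eq_sym.
  by rewrite expf_eq0 n0 normr_eq0 /= => /eqP ->; rewrite mul0r.
exists x, (q / x); split; rewrite //; last by rewrite mulrCA divff ?mulr1.
have nx' : cmod x ^+ n != 0 by rewrite expf_neq0 ?normr_eq0.
apply: (mulfI nx'); rewrite -exprMn -cnormM mulrCA divff // mulr1.
by rewrite xE uv.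
Qed.

(** Divide: [conj(w3) = b / w1^n] if [w1 != 0], otherwise [w3 = a / w2^n] if [w2 != 0]. When both
    vanish, so do [a] and [b], and any [w3] of modulus [sqrt r] is suitable. *)
Lemma exists_w3 (n : nat) w1 w2 a b (r : R) : 0 <= r ->
  cmod a ^+ 2 = cmod w2 ^+ (2 * n) * r -> cmod b ^+ 2 = cmod w1 ^+ (2 * n) * r ->
  a * b = r%:C%C * (w1 * w2) ^+ n ->
  exists w3, [/\ cmod w3 ^+ 2 = r, w2 ^+ n * w3 = a & w1 ^+ n * cj w3 = b].
Proof.
rewrite !(mulnC 2%N n) !exprM -!(cnormX _ n) => r0 aE bE; rewrite exprMn.
move: (w1 ^+ n) (w2 ^+ n) aE bE => x y aE bE ab.
have nz z : cmod z ^+ 2 = 0 -> z = 0.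
  by move/eqP; rewrite expf_eq0 normr_eq0 => /eqP.
have [x0|x0] := eqVneq x 0; last first.
  have h : cmod (cj (b / x)) ^+ 2 = r.
    have nx2 : cmod x ^+ 2 != 0 by rewrite expf_neq0 ?normr_eq0.
    by apply: (mulfI nx2); rewrite -bE cnorm_conj -exprMn -cnormM mulrCA divff ?mulr1.
  have cb : x * cj (cj (b / x)) = b by rewrite conjcK mulrCA divff ?mulr1.
  exists (cj (b / x)); split=> //.
  (* It remains to recover [a]. If [b = 0], then [r = 0] and hence [a = 0]; otherwise [b] can be
     cancelled from [a b = r c]. *)
  have [b0|b0] := eqVneq b 0.
    move: h aE; rewrite b0 mul0r (conjc0 R) normr0 expr0n /= => <-.
    by rewrite mulr0 => /nz ->; rewrite mulr0.
  apply: (mulIf b0); rewrite ab -{2}cb -{}h -mulr_conj; ring.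
have b0 : b = 0 by apply: nz; rewrite bE x0 normr0 expr0n mul0r.
have [y0|y0] := eqVneq y 0; last first.
  exists (a / y); rewrite x0 mul0r b0 mulrCA divff ?mulr1 //; split=> //.
  have ny2 : cmod y ^+ 2 != 0 by rewrite expf_neq0 ?normr_eq0.
  by apply: (mulfI ny2); rewrite -aE -exprMn -cnormM mulrCA divff ?mulr1.
have a0 : a = 0 by apply: nz; rewrite aE y0 normr0 expr0n mul0r.
exists (Num.sqrt r)%:C%C; rewrite x0 y0 !mul0r a0 b0; split=> //.
by rewrite cnorm_real ger0_norm ?sqrtr_ge0 // sqr_sqrtr.
Qed.

(** Since [(u + v)^2 = s + 2 k] and [(u - v)^2 = s - 2 k], the numbers are the half sum and half
    difference of two square roots. *)
Lemma exists_sum_sqr_prod (s k : R) : 0 <= k -> 2 * k <= s ->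
  exists u v, [/\ 0 <= u, 0 <= v, u ^+ 2 + v ^+ 2 = s & u * v = k].
Proof.
move=> k0 ks; pose x := Num.sqrt (s + 2 * k); pose y := Num.sqrt (s - 2 * k).
have xE : x ^+ 2 = s + 2 * k by rewrite sqr_sqrtr //; lra.
have yE : y ^+ 2 = s - 2 * k by rewrite sqr_sqrtr //; lra.
have yx : y <= x by apply: ler_wsqrtr; lra.
have y0 : 0 <= y by exact: sqrtr_ge0.
exists ((x + y) / 2), ((x - y) / 2); split; [lra|lra| |].
  have -> : ((x + y) / 2) ^+ 2 + ((x - y) / 2) ^+ 2 = (x ^+ 2 + y ^+ 2) / 2 by field.
  by rewrite xE yE; lra.
have -> : ((x + y) / 2) * ((x - y) / 2) = (x ^+ 2 - y ^+ 2) / 4 by field.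
by rewrite xE yE; lra.
Qed.

Lemma w_surjective (n : nat) (p q : Rcomplex R) (t : R) : (0 < n)%N ->
  exists w1 w2 w3, [/\ w2 ^+ n * w3 + w1 ^+ n * cj w3 = p, w1 * w2 = q &
    cmod w3 ^+ 2 - (cmod w1 ^+ (2 * n) + cmod w2 ^+ (2 * n)) = t].
Proof.
move=> n0; have [r [r0 rt rE]] := radius_exists p (q ^+ n) t.
have [a [b [ab_sum ab_prod]]] := sum_prod_roots p (r%:C%C * q ^+ n).
have ab_sqr : cmod a ^+ 2 + cmod b ^+ 2 = r * (r - t).
  have := parallelogram a b; rewrite ab_sum ab_prod -rE; lra.
(* These are the future [|w1|^n] and [|w2|^n]. For [r != 0] they are read off from [|b|] and [|a|].
   For [r = 0] both [a] and [b] vanish, and the bound [t + 2 |c| <= r] allows the sum of squares and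
   the product to be prescribed. *)
have [u [v [u0 v0 uv_sum uv_prod [av bu]]]] : exists u v, [/\ 0 <= u, 0 <= v,
    u ^+ 2 + v ^+ 2 = r - t, u * v = cmod q ^+ n &
    cmod a ^+ 2 = v ^+ 2 * r /\ cmod b ^+ 2 = u ^+ 2 * r].
  have [r00|nr] := eqVneq r 0.
    have [|u [v [u0 v0 su pr]]] := @exists_sum_sqr_prod (r - t) (cmod (q ^+ n)) (normr_ge0 _).
      by lra.
    exists u, v; rewrite -cnormX; split=> //.
    rewrite r00 !mulr0; rewrite r00 mul0r in ab_sqr.
    by have := sqr_ge0 (cmod a); have := sqr_ge0 (cmod b); split; lra.
  have rp : 0 < r by rewrite lt0r nr.
  have sq : Num.sqrt r ^+ 2 = r by rewrite sqr_sqrtr.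
  have sn : Num.sqrt r != 0 by rewrite gt_eqF ?sqrtr_gt0.
  exists (cmod b / Num.sqrt r), (cmod a / Num.sqrt r).
  have E z : (cmod z / Num.sqrt r) ^+ 2 = cmod z ^+ 2 / r by rewrite expr_div_n sq.
  rewrite !E !divfK //; split=> //; rewrite ?divr_ge0 ?sqrtr_ge0 //.
    by rewrite -mulrDl addrC ab_sqr mulrC mulKf.
  rewrite mulf_div -expr2 sq -cnormM (mulrC b) ab_prod cnorm_realM ger0_norm //.
  by rewrite mulrAC divff // mul1r cnormX.
have [w1 [w2 [e1 e2 qE]]] := exists_factors n0 u0 v0 uv_prod.
have [||//|w3 [e3 eb ea]] := @exists_w3 n w1 w2 a b r r0.
- by rewrite mulnC exprM e2.
- by rewrite mulnC exprM e1.
- by rewrite qE.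
exists w1, w2, w3; rewrite eb ea; split=> //.
by rewrite !(mulnC 2%N n) !exprM e1 e2 e3 uv_sum; lra.
Qed.
End Surjectivity.

(** * Generated linear groups and their invariants *)

Section LinearGroupTheory.
Context {R : realType} {V : lmodType R}.

Lemma GL_linear_group : is_linear_group (GL : set (V -> V)).
Proof.
split=> //.
- by split; [move=> a u v | exists idfun].
- move=> g h [gl gb] [hl hb]; split; last exact: bij_comp.
  by move=> a u v; exact: etrans (congr1 g (hl a u v)) (gl _ _ _).
- move=> g h [gl gb] gh hg; split; last by exists g.
  by move=> a u v; apply: (can_inj gh); rewrite gl !hg.
Qed.

(** The assumption [S <= GL] makes [GL] one of the groups being intersected, which keeps the
    intersection inside [GL]. *)
Lemma generated_group_linear_group (S : set (V -> V)) :
  S `<=` GL -> is_linear_group (generated_group S).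
Proof.
move=> SGL; split.
- by apply: smallest_sub => //; exact: GL_linear_group.
- by move=> G [/linear_group_id].
- move=> g h Sg Sh G [GG SG].
  by apply: (linear_group_comp GG); [exact: Sg|exact: Sh].
- move=> g h Sg gh hg G [GG SG].
  by apply: (linear_group_inv GG _ gh hg); exact: Sg.
Qed.

(** By minimality of the generated group, this turns invariance under generators into invariance
    under the whole group. *)
Lemma invariance_group_linear_group {W : Type} (f : V -> W) :
  is_linear_group [set g | GL g /\ forall x, f (g x) = f x].
Proof.
split.
- by move=> g [].
- by split=> //; exact: linear_group_id GL_linear_group.
- move=> g h [gGL gf] [hGL hf]; split; last by move=> x /=; rewrite gf hf.
  exact: (linear_group_comp GL_linear_group).
- move=> g h [gGL gf] gh hg; split.
    exact: (linear_group_inv GL_linear_group gGL).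
  by move=> x; rewrite -[in RHS](hg x) gf.
Qed.

Lemma generated_group_invariant {W : Type} (S : set (V -> V)) (f : V -> W) :
  S `<=` GL -> (forall g x, S g -> f (g x) = f x) ->
  forall g x, generated_group S g -> f (g x) = f x.
Proof.
move=> SGL Sf g x Sg.
have [] // : [set g | GL g /\ forall x, f (g x) = f x] g.
  apply: Sg; split; first exact: invariance_group_linear_group.
  by move=> h Sh; split=> [|y]; [exact: SGL|exact: Sf].
Qed.

End LinearGroupTheory.

(** * The group in both coordinate systems and its factorization map *)

Section Group11n.
Context {R : realType}.

Definition torus_op (n : nat) (l : Rcomplex R) : C3 R -> C3 R :=
  fun z => (l * z.1.1, l * z.1.2, l ^+ n * z.2).

Definition conj_op : C3 R -> C3 R := fun z => (conjc z.1.1, conjc z.1.2, conjc z.2).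

Lemma C3_eq (x y z x' y' z' : Rcomplex R) : x = x' -> y = y' -> z = z' ->
  (x, y, z) = (x', y', z') :> C3 R.
Proof. by move=> -> -> ->. Qed.

Lemma torus_op_GL n l : cmod l = 1 -> GL (torus_op n l).
Proof.
move=> l1; have l0 : l != 0 by rewrite -normr_eq0 l1 oner_eq0.
split.
  have mulP (m x y : Rcomplex R) (a : R) : m * (a *: x + y) = a *: (m * x) + m * y.
    by rewrite !scale_realE; ring.
  by move=> a [[u1 u2] u3] [[v1 v2] v3]; apply: C3_eq; exact: mulP.
exists (torus_op n l^-1) => -[[z1 z2] z3]; apply: C3_eq => /=.
all: by rewrite mulrA -?exprMn ?mulVf ?divff ?expr1n ?mul1r.
Qed.

Lemma conj_op_GL : GL conj_op.
Proof.
split; last by exists conj_op => -[[z1 z2] z3]; apply: C3_eq; exact: conjcK.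
by move=> a [[u1 u2] u3] [[v1 v2] v3]; apply: C3_eq => /=; rewrite (linearP conjc).
Qed.

(** Chosen so that [group_11n n] unfolds to the group generated by this set. *)
Definition generators_11n (n : nat) : set (C3 R -> C3 R) :=
  [set g | exists2 l : Rcomplex R, cmod l = 1 & g = torus_op n l] `|` [set conj_op].

Lemma generators_11n_GL n : generators_11n n `<=` GL.
Proof. by move=> g [[l l1 ->]|->]; [exact: torus_op_GL|exact: conj_op_GL]. Qed.

Lemma sqr_imag : ('i%C : Rcomplex R) * 'i%C = -1.
Proof. by apply: RcomplexP => /=; ring. Qed.

Lemma cj_imag : cj 'i%C = - 'i%C :> Rcomplex R.
Proof. by apply: RcomplexP => /=; rewrite ?oppr0. Qed.

(** Because [conj(w2) = z1 - i z2], the first two entries are the half sum and half difference of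
    [w1] and [conj(w2)], the latter divided by [i]. *)
Definition w_coords_inv (w : C3 R) : C3 R :=
  ((w.1.1 + cj w.1.2) / 2, - 'i%C * ((w.1.1 - cj w.1.2) / 2), w.2).

Lemma w_coordsK : cancel (w_coords : C3 R -> C3 R) w_coords_inv.
Proof.
have h2 := @two_neq0 R.
move=> [[z1 z2] z3]; apply: C3_eq => //=; rewrite conjcK; first by field.
transitivity (- ('i%C * 'i%C) * z2 : Rcomplex R); first by field.
by rewrite sqr_imag; ring.
Qed.

Lemma w_coords_invK : cancel w_coords_inv (w_coords : C3 R -> C3 R).
Proof.
have h2 := @two_neq0 R.
move=> [[w1 w2] w3]; apply: C3_eq => //=.
  transitivity ((w1 + cj w2) / 2 - ('i%C * 'i%C) * ((w1 - cj w2) / 2) : Rcomplex R); first by field.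
  by rewrite sqr_imag; field.
transitivity (cj ((w1 + cj w2) / 2 + ('i%C * 'i%C) * ((w1 - cj w2) / 2))).
  by congr conjc; ring.
by rewrite sqr_imag -[RHS]conjcK; congr conjc; field.
Qed.

Lemma w_coords_GL : GL (w_coords : C3 R -> C3 R).
Proof.
split; last by exists w_coords_inv; [exact: w_coordsK|exact: w_coords_invK].
move=> a [[u1 u2] u3] [[v1 v2] v3]; apply: C3_eq => //=.
  by rewrite !scale_realE; ring.
rewrite -(linearP conjc); congr conjc.
by rewrite !scale_realE; ring.
Qed.

Definition w_torus (n : nat) (l : Rcomplex R) : C3 R -> C3 R :=
  fun w => (l * w.1.1, conjc l * w.1.2, l ^+ n * w.2).
Definition w_swap : C3 R -> C3 R := fun w => (w.1.2, w.1.1, conjc w.2).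

Lemma w_coords_torus n l z : w_coords (torus_op n l z) = w_torus n l (w_coords z).
Proof.
apply: C3_eq => //=; first by ring.
by rewrite -cjM; congr conjc; ring.
Qed.

Lemma w_coords_conj z : w_coords (conj_op z) = w_swap (w_coords z).
Proof.
by apply: C3_eq => //=; rewrite !(cjB, cjD, cjM) ?conjcK cj_imag; ring.
Qed.

(** Already the generating sets agree. As [w_coords] is injective, an operator is determined by its
    reading in the [w] coordinates, where complex conjugation becomes the swap. *)
Lemma in_coords_w_generators n : in_coords w_coords (w_generators n) = generators_11n n.
Proof.
apply/seteqP; split=> g /=.
- move=> [h [[l l1 ->]|->] gh]; [left; exists l => //|right; rewrite /=]; apply/funext=> z;
    apply: (can_inj w_coordsK); rewrite gh.
    by rewrite w_coords_torus.
  by rewrite w_coords_conj.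
- move=> [[l l1 ->]|->].
    by exists (w_torus n l); [left; exists l|exact: w_coords_torus].
  by exists w_swap; [right|exact: w_coords_conj].
Qed.

Lemma w_map_torus n l w : cmod l = 1 -> w_map n (w_torus n l w) = w_map n w.
Proof.
move=> l1; have l0 : l != 0 by rewrite -normr_eq0 l1 oner_eq0.
have ll : cj l * l = 1 by rewrite cj_unit // mulVf.
rewrite /w_map /= !cnormM cnormX cnorm_conj l1 expr1n !mul1r.
congr (_, _, _); last by rewrite mulrACA (mulrC l) ll mul1r.
rewrite !exprMn (cjM _ w.2) cjX.
have lln : cj l ^+ n * l ^+ n = 1 by rewrite -exprMn ll expr1n.
transitivity (cj l ^+ n * l ^+ n * (w.1.2 ^+ n * w.2 + w.1.1 ^+ n * cj w.2)).
  by ring.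
by rewrite lln mul1r.
Qed.

Lemma w_map_swap n w : w_map n (w_swap w) = w_map n w.
Proof.
by rewrite /w_map /= conjcK cnorm_conj [X in (X, _, _)]addrC (mulrC w.1.2) (addrC (_ ^+ (2 * n))).
Qed.

Lemma w_map_factorization n : (0 < n)%N ->
  factorization_map (group_11n n) (fun z : C3 R => w_map n (w_coords z)).
Proof.
move=> n0; split=> [[[p q] t]|x y].
  have [w1 [w2 [w3 [e1 e2 e3]]]] := w_surjective p q t n0.
  by exists (w_coords_inv (w1, w2, w3)); rewrite w_coords_invK /w_map /= e1 e2 e3.
have [_ _ gcomp _] := generated_group_linear_group (@generators_11n_GL n).
have gen g : generators_11n n g -> group_11n n g by exact: sub_smallest.
split; last first.
  move=> [g Gg ->]; apply/esym.
  apply: (generated_group_invariant (f := fun z => w_map n (w_coords z)) (@generators_11n_GL n)) Gg.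
  move=> _ {}x [[l l1 ->]|->]; first by rewrite w_coords_torus w_map_torus.
  by rewrite w_coords_conj w_map_swap.
case=> e1 e2 e3.
have [l l1 h] := w_fibre n0 (esym e1) (esym e2) (esym e3).
have torusG : group_11n n (torus_op n l) by apply: gen; left; exists l.
case: h => -[h1 h2 h3].
  exists (torus_op n l) => //; apply: (can_inj w_coordsK).
  by rewrite w_coords_torus; apply: C3_eq.
(* In the second case of [w_fibre] the swap acts first, and it is [conj_op] in the original
   coordinates. *)
exists (torus_op n l \o conj_op); first by apply: gcomp => //; apply: gen; right.
apply: (can_inj w_coordsK).
by rewrite /= w_coords_torus w_coords_conj; apply: C3_eq.
Qed.

End Group11n.

(** * Polynomiality and the identification of the target with real 5-space *)

Section RealPolynomials.
Context {R : realType}.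

Definition polynomial_function (g : C3 R -> R) : Prop :=
  exists p : mpoly.mpoly 6 R, forall z, g z = mpoly.meval (real_coords z) p.

Definition complex_polynomial (f : C3 R -> Rcomplex R) : Prop :=
  polynomial_function (fun z => complex.Re (f z)) /\
  polynomial_function (fun z => complex.Im (f z)).

Lemma polynomial_const (k : R) : polynomial_function (fun=> k).
Proof. by exists (mpoly.mpolyC 6 k) => z; rewrite mpoly.mevalC. Qed.

Lemma polynomial_add g h : polynomial_function g -> polynomial_function h ->
  polynomial_function (fun z => g z + h z).
Proof. by move=> [p gp] [q hq]; exists (p + q) => z; rewrite mpoly.mevalD gp hq. Qed.

Lemma polynomial_sub g h : polynomial_function g -> polynomial_function h ->
  polynomial_function (fun z => g z - h z).
Proof. by move=> [p gp] [q hq]; exists (p - q) => z; rewrite mpoly.mevalB gp hq. Qed.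

Lemma polynomial_opp g : polynomial_function g -> polynomial_function (fun z => - g z).
Proof. by move=> [p gp]; exists (- p) => z; rewrite mpoly.mevalN gp. Qed.

Lemma polynomial_mul g h : polynomial_function g -> polynomial_function h ->
  polynomial_function (fun z => g z * h z).
Proof. by move=> [p gp] [q hq]; exists (p * q) => z; rewrite mpoly.mevalM gp hq. Qed.

Lemma polynomial_exp g k : polynomial_function g -> polynomial_function (fun z => g z ^+ k).
Proof.
move=> gp; elim: k => [|k IH]; first exact: polynomial_const.
by under eq_fun do rewrite exprS; exact: polynomial_mul.
Qed.

Lemma polynomial_coord (i : 'I_6) : polynomial_function (fun z => real_coords z i).
Proof. by exists (mpoly.mpolyX R (mpoly.mnm1 i)) => z; rewrite mpoly.mevalXU. Qed.

Lemma complex_polynomial_coords :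
  [/\ complex_polynomial (fun z => z.1.1), complex_polynomial (fun z => z.1.2) &
      complex_polynomial (fun z => z.2)].
Proof.
split; split.
- exact: (polynomial_coord (@Ordinal 6 0 isT)).
- exact: (polynomial_coord (@Ordinal 6 1 isT)).
- exact: (polynomial_coord (@Ordinal 6 2 isT)).
- exact: (polynomial_coord (@Ordinal 6 3 isT)).
- exact: (polynomial_coord (@Ordinal 6 4 isT)).
- exact: (polynomial_coord (@Ordinal 6 5 isT)).
Qed.

Lemma complex_polynomial_const (k : Rcomplex R) : complex_polynomial (fun=> k).
Proof. by split; exact: polynomial_const. Qed.

Lemma complex_polynomial_add f g : complex_polynomial f -> complex_polynomial g ->
  complex_polynomial (fun z => f z + g z).
Proof.
move=> [f1 f2] [g1 g2]; split; under eq_fun do rewrite raddfD; exact: polynomial_add.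
Qed.

Lemma complex_polynomial_conj f : complex_polynomial f -> complex_polynomial (fun z => cj (f z)).
Proof.
move=> [f1 f2]; split.
  by under eq_fun => z do have -> : complex.Re (cj (f z)) = complex.Re (f z) by case: (f z).
under eq_fun => z do have -> : complex.Im (cj (f z)) = - complex.Im (f z) by case: (f z).
exact: polynomial_opp.
Qed.

Lemma complex_polynomial_mul f g : complex_polynomial f -> complex_polynomial g ->
  complex_polynomial (fun z => f z * g z).
Proof.
move=> [f1 f2] [g1 g2]; split.
  under eq_fun => z do have -> : complex.Re (f z * g z) =
    complex.Re (f z) * complex.Re (g z) - complex.Im (f z) * complex.Im (g z)
    by case: (f z) (g z) => [? ?] [? ?].
  by apply: polynomial_sub; exact: polynomial_mul.
under eq_fun => z do have -> : complex.Im (f z * g z) =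
  complex.Re (f z) * complex.Im (g z) + complex.Im (f z) * complex.Re (g z)
  by case: (f z) (g z) => [? ?] [? ?].
by apply: polynomial_add; exact: polynomial_mul.
Qed.

Lemma complex_polynomial_exp f k : complex_polynomial f -> complex_polynomial (fun z => f z ^+ k).
Proof.
move=> fp; elim: k => [|k IH]; first exact: complex_polynomial_const.
by under eq_fun do rewrite exprS; exact: complex_polynomial_mul.
Qed.

Lemma polynomial_cnorm_sqr f : complex_polynomial f ->
  polynomial_function (fun z => cmod (f z) ^+ 2).
Proof.
move=> [f1 f2]; under eq_fun do rewrite cnorm_sqr.
by apply: polynomial_add; exact: polynomial_exp.
Qed.

(** Reduces polynomiality of a vector-valued map to that of its scalar coefficients, whose
    polynomials are picked by choice. *)
Lemma real_polynomial_sum {V : lmodType R} m (g : C3 R -> 'I_m -> R) (v : 'I_m -> V) f :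
  (forall k, polynomial_function (g^~ k)) ->
  (forall z, f z = \sum_(k < m) g z k *: v k) -> real_polynomial f.
Proof.
move=> /choice[p gp] fE; exists m, p, v => z.
by rewrite fE; apply: eq_bigr => k _; rewrite gp.
Qed.

Definition target_coords (u : Rcomplex R * Rcomplex R * R^o) : 'I_5 -> R :=
  tnth [tuple complex.Re u.1.1; complex.Im u.1.1;
              complex.Re u.1.2; complex.Im u.1.2; u.2].

Lemma forall_ord5 (P : 'I_5 -> Prop) :
  P (@Ordinal 5 0 isT) -> P (@Ordinal 5 1 isT) -> P (@Ordinal 5 2 isT) ->
  P (@Ordinal 5 3 isT) -> P (@Ordinal 5 4 isT) -> forall k, P k.
Proof.
move=> p0 p1 p2 p3 p4 [k lk].
by move: k lk => [|[|[|[|[|//]]]]] lk; rewrite (bool_irrelevance lk isT).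
Qed.

Lemma target_coords_inj u v : target_coords u =1 target_coords v -> u = v.
Proof.
move: u v => [[[a b] [c d]] e] [[[a' b'] [c' d']] e'] uv.
have := uv (@Ordinal 5 0 isT); have := uv (@Ordinal 5 1 isT); have := uv (@Ordinal 5 2 isT).
have := uv (@Ordinal 5 3 isT); have := uv (@Ordinal 5 4 isT).
by rewrite /target_coords !(tnth_nth 0) /= => -> -> -> -> ->.
Qed.

Lemma target_coords_surj (t : 'I_5 -> R) : exists u, target_coords u =1 t.
Proof.
exists ((t (@Ordinal 5 0 isT) +i* t (@Ordinal 5 1 isT))%C,
        (t (@Ordinal 5 2 isT) +i* t (@Ordinal 5 3 isT))%C, t (@Ordinal 5 4 isT)).
by apply: forall_ord5; rewrite /target_coords (tnth_nth 0).
Qed.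

Lemma target_coords_polynomial n k :
  polynomial_function (fun z => target_coords (w_map n (w_coords z)) k).
Proof.
have [z1 z2 z3] := complex_polynomial_coords.
have iz2 : complex_polynomial (fun z => 'i%C * z.1.2).
  by apply: complex_polynomial_mul => //; exact: complex_polynomial_const.
have w1 : complex_polynomial (fun z => (w_coords z).1.1).
  exact: complex_polynomial_add.
have w2 : complex_polynomial (fun z => (w_coords z).1.2).
  apply: complex_polynomial_conj; apply: complex_polynomial_add => //.
  under eq_fun do rewrite -mulN1r.
  by apply: complex_polynomial_mul => //; exact: complex_polynomial_const.
have [p1 p2] : complex_polynomial (fun z => (w_map n (w_coords z)).1.1).
  apply: complex_polynomial_add; apply: complex_polynomial_mul => //.
  - exact: complex_polynomial_exp.
  - exact: complex_polynomial_exp.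
  - exact: complex_polynomial_conj.
have [p3 p4] : complex_polynomial (fun z => (w_map n (w_coords z)).1.2).
  exact: complex_polynomial_mul.
have p5 : polynomial_function (fun z => (w_map n (w_coords z)).2).
  (* The power [|w|^(2n)] is read as [(|w|^2)^n], since [|w|^2] is polynomial while [|w|] is not. *)
  rewrite /w_map /=; under eq_fun do rewrite !exprM.
  apply: polynomial_sub; first exact: polynomial_cnorm_sqr.
  by apply: polynomial_add; apply: polynomial_exp; exact: polynomial_cnorm_sqr.
by move: k; apply: forall_ord5.
Qed.

Lemma w_map_polynomial n : real_polynomial (fun z : C3 R => w_map n (w_coords z)).
Proof.
pose v : 'I_5 -> (Rcomplex R * Rcomplex R * R^o)%type :=
  tnth [tuple (1, 0, 0); ('i%C, 0, 0); (0, 1, 0); (0, 'i%C, 0); (0, 0, 1)].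
apply: (real_polynomial_sum (v := v) (@target_coords_polynomial n)) => z.
move: (w_map n (w_coords z)) => [[[a b] [c d]] e].
rewrite !big_ord_recl big_ord0 /target_coords /v !(tnth_nth 0) /=.
apply: target_coords_inj; apply: forall_ord5.
all: by rewrite /target_coords !(tnth_nth 0) /= /GRing.scale /=; ring.
Qed.

(** Composing with the bijection [target_coords] preserves both surjectivity and fibres. *)
Lemma real5_factorization n : (0 < n)%N ->
  exists f : C3 R -> 'rV[R]_5, real_polynomial f /\ factorization_map (group_11n n) f.
Proof.
move=> n0; have [surj fib] := @w_map_factorization R n n0.
exists (fun z => \row_k target_coords (w_map n (w_coords z)) k); split.
  apply: (real_polynomial_sum (v := fun k => delta_mx 0 k) (@target_coords_polynomial n)) => z.
  by rewrite [LHS]row_sum_delta; apply: eq_bigr => k _; rewrite mxE.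
split=> [t|x y].
  have [u ut] := target_coords_surj (t 0); have [z zu] := surj u.
  by exists z; apply/rowP => k; rewrite mxE zu ut.
rewrite -fib; split=> [/rowP e|-> //].
by apply: target_coords_inj => k; have := e k; rewrite !mxE.
Qed.
End RealPolynomials.

Theorem mainTheorem1 (R : realType) (n : nat) (hn : (1 <= n)%N) :
  is_linear_group (group_11n n : set (C3 R -> C3 R)) /\
  (exists f : C3 R -> 'rV[R]_5,
     real_polynomial f /\ factorization_map (group_11n n) f) /\
  [/\ GL (w_coords : C3 R -> C3 R),
      group_11n n =
        generated_group (in_coords w_coords (w_generators n))
        :> set (C3 R -> C3 R),
      real_polynomial (fun z : C3 R => w_map n (w_coords z)) &
      factorization_map (group_11n n)
        (fun z : C3 R => w_map n (w_coords z))].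
Proof.
split; first exact: generated_group_linear_group (@generators_11n_GL R n).
split; first exact: real5_factorization.
split.
- exact: w_coords_GL.
- by rewrite in_coords_w_generators.
- exact: w_map_polynomial.
- exact: w_map_factorization.
Qed.
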